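(* Let $\mathbb{K}$ be a commutative field, $V$ a linear hyperplane of $\operatorname{M}_2(\mathbb{K})$, and $f : V \to \operatorname{M}_2(\mathbb{K})$ an injective linear map such that $f(V \cap \operatorname{GL}_2(\mathbb{K}))\subset \operatorname{GL}_2(\mathbb{K})$. Then $f$ extends to a Frobenius automorphism of $\operatorname{M}_2(\mathbb{K})$, unless $V$ is equivalent to $T_2^+(\mathbb{K})$ and $\# \mathbb{K} \leq 3$ (i.e. the conclusion is asserted whenever these two conditions do not both hold).
   Context: $T_2^+(\mathbb{K})$ is the space of upper triangular matrices of $\operatorname{M}_2(\mathbb{K})$. Two linear subspaces $V,W$ of $\operatorname{M}_2(\mathbb{K})$ are equivalent if $W=PVQ^{-1}$ for some $P,Q\in \operatorname{GL}_2(\mathbb{K})$. A Frobenius automorphism of $\operatorname{M}_2(\mathbb{K})$ is a map of the form $M\mapsto PMQ$ or of the form $M \mapsto PM^TQ$ for some $P,Q\in\operatorname{GL}_2(\mathbb{K})$. *)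

(* Defs.v *)
From HB Require Import structures.
From mathcomp Require Import all_boot all_order all_algebra.
From mathcomp Require Import classical_sets functions cardinality.

Set Implicit Arguments.
Unset Strict Implicit.
Unset Printing Implicit Defensive.

Import GRing.Theory.
Local Open Scope ring_scope.

Definition is_hyperplane (K : fieldType) (vT : vectType K)
    (V : {vspace vT}) : Prop :=
  (\dim V).+1 = \dim {:vT}.

Definition upper_triangular (K : fieldType) (n : nat) : {vspace 'M[K]_n} :=
  (\sum_(i < n) \sum_(j < n | (i <= j)%N) <[delta_mx i j]>)%VS.

Lemma upper_triangularP (K : fieldType) (n : nat) (M : 'M[K]_n) :
  reflect (forall i j : 'I_n, (j < i)%N -> M i j = 0)
          (M \in upper_triangular K n).
Proof.
apply: (iffP idP) => [/memv_sumP[u uP ->] i j ltji | M0].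
  rewrite summxE big1 // => k _.
  have /memv_sumP[w wP ->] := uP k isT.
  rewrite summxE big1 // => l lekl.
  have /vlineP[c ->] := wP l lekl.
  rewrite !mxE; case: eqP => [eik|]; last by rewrite mulr0.
  case: eqP => [ejl|]; last by rewrite mulr0.
  by move: lekl; rewrite -eik -ejl leqNgt ltji.
rewrite [M]matrix_sum_delta; apply: memv_sumr => i _.
rewrite (bigID (fun j : 'I_n => (i <= j)%N)) /= [X in _ + X]big1 ?addr0.
  by apply: memv_sumr => j _; rewrite memvZ ?memv_line.
by move=> j; rewrite -ltnNge => /M0 ->; rewrite scale0r.
Qed.

(* [mulmxr (invmx Q) \o mulmx P] is the linear map M |-> P M Q^-1. *)
Definition equivalent_spaces (K : fieldType) (n : nat)
    (V W : {vspace 'M[K]_n}) : Prop :=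
  exists P Q : 'M[K]_n,
    [/\ P \in unitmx, Q \in unitmx
      & W = (linfun (mulmxr (invmx Q) \o mulmx P) @: V)%VS].

Definition is_Frobenius (K : fieldType) (n : nat)
    (u : 'M[K]_n -> 'M[K]_n) : Prop :=
  exists P Q : 'M[K]_n,
    [/\ P \in unitmx, Q \in unitmx
      & (forall M, u M = P *m M *m Q) \/ (forall M, u M = P *m M^T *m Q)].

(* Main.v *)
Require Import Defs.
From HB Require Import structures.
From mathcomp Require Import all_boot all_order all_algebra.
From mathcomp Require Import classical_sets functions cardinality.
From mathcomp Require Import boolp ring.

Set Implicit Arguments.
Unset Strict Implicit.
Unset Printing Implicit Defensive.

Import GRing.Theory.
Local Open Scope ring_scope.

(** A hyperplane of the space of 2 x 2 matrices is the kernel of M |-> tr (A M)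
for some nonzero A. Reducing A to its rank normal form shows that, up to
equivalence, it consists of the matrices

      N(a, b, c) = (a, b; s b, c),   with det N(a, b, c) = a c - s b^2,

where s = 0 if A has rank 1 (upper triangular matrices) and s = 1 if A has
rank 2 (symmetric matrices). Both V and f(V) are hyperplanes, so both are
parametrized in this way, with parameters s and t respectively.

The heart of the proof is that det v = k det (f v) on V for some nonzero k.
In the coordinates (a, b, c) of f(V), the determinant of v is a ternary
quadratic form q that vanishes wherever a c = t b^2. If t = 0, this zero locus
is a union of two planes, and q is a multiple of a c. If t = 1, then q vanishes
at (1, 0, 0) and (0, 0, 1), and its value at the point (x^2, x, 1) of the conic is
x (d x^2 + e x + g), where all three of d, e, g vanish if and only if q is a
multiple of a c - b^2. They do vanish
as soon as the field has three distinct nonzero elements. Over the fields with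
two or three elements, V is not equivalent to the upper triangular matrices, so
s = 1 and V contains no plane of singular matrices; hence the half-discriminant
of q is nonzero, and this again forces d = e = g = 0
([det_comb3_conic], [det_proportional]).

Once the determinants are proportional, let A, B, C be the images under f of the
basis N(1, 0, 0), N(0, 1, 0), N(0, 0, 1) of V, so that
det (a A + b B + c C) = k (a c - s b^2) for some nonzero k. Multiplying on both
sides by invertible matrices turns A into E11 and C into E22. The determinant
then leaves B = (0, p; r, 0) with p r = s, and a diagonal equivalence, preceded
by a transposition if p = 0, maps N(a, b, c) to a A + b B + c C
([Frobenius_of_det]). *)

(** * Matrices of size two *)

(** The matrix with rows (a, b) and (c, d). *)
Definition mx2 (K : fieldType) (a b c d : K) : 'M[K]_2 :=
  \matrix_(i, j) (if i == 0 then if j == 0 then a else b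
                  else if j == 0 then c else d).

Section TwoByTwo.
Variable K : fieldType.
Implicit Types (a b c d : K) (M N A B C : 'M[K]_2).

Lemma mx2_eta M : M = mx2 (M 0 0) (M 0 1) (M 1 0) (M 1 1).
Proof.
by apply/matrixP => -[[|[|//]] ?] [[|[|//]] ?]; rewrite !mxE; congr (M _ _);
   apply/val_inj.
Qed.

Lemma mx2_add a b c d a' b' c' d' :
  mx2 a b c d + mx2 a' b' c' d' = mx2 (a + a') (b + b') (c + c') (d + d').
Proof. by rewrite [LHS]mx2_eta !mxE. Qed.

Lemma mx2_scale x a b c d :
  x *: mx2 a b c d = mx2 (x * a) (x * b) (x * c) (x * d).
Proof. by rewrite [LHS]mx2_eta !mxE. Qed.

Lemma mx2_mul a b c d a' b' c' d' :
  mx2 a b c d *m mx2 a' b' c' d' =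
  mx2 (a * a' + b * c') (a * b' + b * d') (c * a' + d * c') (c * b' + d * d').
Proof. by rewrite [LHS]mx2_eta !mxE !big_ord_recl !big_ord0 !mxE /= !addr0. Qed.

Lemma mx2_tr a b c d : (mx2 a b c d)^T = mx2 a c b d.
Proof. by rewrite [LHS]mx2_eta !mxE. Qed.

Lemma det_mx22 M : \det M = M 0 0 * M 1 1 - M 0 1 * M 1 0.
Proof.
rewrite [M in LHS]mx2_eta (expand_det_row _ 0) !big_ord_recl big_ord0 addr0.
rewrite /cofactor !det_mx11 !mxE /= expr0 expr1 !mul1r mulN1r mulrN.
by [].
Qed.

Lemma det_mx2 a b c d : \det (mx2 a b c d) = a * d - b * c.
Proof. by rewrite det_mx22 !mxE. Qed.

Lemma mx2_unit a b c d : (mx2 a b c d \in unitmx) = (a * d - b * c != 0).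
Proof. by rewrite unitmxE det_mx2 unitfE. Qed.

Lemma unitmx_det_neq0 M : (M \in unitmx) = (\det M != 0).
Proof. by rewrite unitmxE unitfE. Qed.

(** The polar form of the determinant: det (A + B) = det A + det B + polar A B. *)
Definition polar A B :=
  A 0 0 * B 1 1 + A 1 1 * B 0 0 - A 0 1 * B 1 0 - A 1 0 * B 0 1.

Lemma det_comb3 A B C a b c :
  \det (a *: A + b *: B + c *: C) =
  \det A * a ^+ 2 + \det B * b ^+ 2 + \det C * c ^+ 2
  + polar A B * (a * b) + polar B C * (b * c) + polar A C * (a * c).
Proof. rewrite /polar !det_mx22 !mxE; ring. Qed.

(** * Fitting a Frobenius automorphism to three matrices *)

Lemma Frobenius_mul (P Q : 'M[K]_2) (u : 'M[K]_2 -> 'M[K]_2) :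
  P \in unitmx -> Q \in unitmx -> is_Frobenius u ->
  is_Frobenius (fun M => P *m u M *m Q).
Proof.
move=> uP uQ [P' [Q' [uP' uQ' H]]]; exists (P *m P'), (Q' *m Q).
split; rewrite ?unitmx_mul ?uP ?uP' ?uQ ?uQ' //.
by case: H => H; [left|right] => M; rewrite H !mulmxA.
Qed.

Lemma Frobenius_comp_mul (P Q : 'M[K]_2) (u : 'M[K]_2 -> 'M[K]_2) :
  P \in unitmx -> Q \in unitmx -> is_Frobenius u ->
  is_Frobenius (fun M => u (P *m M *m Q)).
Proof.
move=> uP uQ [P' [Q' [uP' uQ' [] H]]].
  exists (P' *m P), (Q *m Q'); split; rewrite ?unitmx_mul ?uP ?uP' ?uQ ?uQ' //.
  by left=> M; rewrite H !mulmxA.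
exists (P' *m Q^T), (P^T *m Q').
split; rewrite ?unitmx_mul ?unitmx_tr ?uP ?uP' ?uQ ?uQ' //.
by right=> M; rewrite H !trmx_mul !mulmxA.
Qed.

(** Some Frobenius automorphism sends (a, b; s b, c) to a A + b B + c C for all
a, b, c. *)
Definition Frobenius_fits (s : K) A B C := exists u : 'M[K]_2 -> 'M[K]_2,
  is_Frobenius u /\
  forall a b c, u (mx2 a b (s * b) c) = a *: A + b *: B + c *: C.

Lemma Frobenius_fits_equiv s A B C (P Q : 'M[K]_2) :
  P \in unitmx -> Q \in unitmx ->
  Frobenius_fits s (P *m A *m Q) (P *m B *m Q) (P *m C *m Q) ->
  Frobenius_fits s A B C.
Proof.
move=> uP uQ [u [Fu Hu]].
exists (fun M => invmx P *m u M *m invmx Q); split.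
  by apply: Frobenius_mul; rewrite ?unitmx_inv.
move=> a b c; rewrite Hu; apply: (canLR (mulmxK uQ)).
apply: (canLR (mulKmx uP)).
by rewrite mulmxA !mulmxDr !mulmxDl -!scalemxAr -!scalemxAl.
Qed.

(** The determinant forces k = 1 and B = (0, q; r, 0) with q r = s. If q is
nonzero, conjugation by diag(q, 1) has the required effect. Otherwise s = 0, and
the transposition followed by conjugation by diag(1, r) does. *)
Lemma Frobenius_fits_diag s k B : B != 0 ->
  (forall a b c, \det (a *: mx2 1 0 0 0 + b *: B + c *: mx2 0 0 0 1)
     = k * (a * c - s * b ^+ 2)) ->
  Frobenius_fits s (mx2 1 0 0 0) B (mx2 0 0 0 1).
Proof.
rewrite [B]mx2_eta; move: (B 0 0) (B 0 1) (B 1 0) (B 1 1) => p q r t nzB H.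
have {}H a b c : (a + b * p) * (c + b * t) - b ^+ 2 * (q * r)
     = k * (a * c - s * b ^+ 2).
  by rewrite -H !mx2_scale !mx2_add det_mx2; ring.
(* Compare the two sides at (1, 0, 1). *)
have k1 : k = 1.
  have := H 1 0 1; rewrite expr0n !(mulr0, mul0r, mulr1, mul1r, addr0, subr0).
  by move->.
subst k.
(* The determinants of B and of E11 + B are equal, as are those of B and of
   B + E22. *)
have t0 : t = 0.
  apply: (addIr (- s)); transitivity (p * t + t - q * r - p * t + q * r - s).
    by ring.
  have := H 1 1 0; have := H 0 1 0.
  rewrite !(add0r, mul1r, mul0r, expr1n, mulr1, mulr0) => <- E.
  by rewrite -[RHS]E; ring.
have p0 : p = 0.
  apply: (addIr (- s)); transitivity (p * t + p - q * r - p * t + q * r - s).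
    by ring.
  have := H 0 1 1; have := H 0 1 0.
  rewrite !(add0r, mul1r, mul0r, expr1n, mulr1, mulr0) => <- E.
  by rewrite -[RHS]E; ring.
subst t p.
have sE : s = q * r.
  have := H 0 1 0.
  rewrite !(add0r, mul1r, mul0r, expr1n, mulr1, mulr0, oppr0) => /oppr_inj.
  by [].
have [q0|q0] := eqVneq q 0; last first.
  exists (fun M => mx2 q 0 0 1 *m M *m mx2 q^-1 0 0 1); split.
    exists (mx2 q 0 0 1), (mx2 q^-1 0 0 1); split; last by left.
      by rewrite mx2_unit mulr0 subr0 mulr1.
    by rewrite mx2_unit mulr0 subr0 mulr1 invr_eq0.
  move=> a b c; rewrite !mx2_mul !mx2_scale !mx2_add sE.
  by congr mx2; field.
subst q; rewrite mul0r in sE; subst s.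
have r0 : r != 0.
  apply: contraNneq nzB => ->; apply/eqP/matrixP => i j; rewrite !mxE.
  by do 2 case: ifP.
exists (fun M => mx2 1 0 0 r *m M^T *m mx2 1 0 0 r^-1); split.
  exists (mx2 1 0 0 r), (mx2 1 0 0 r^-1); split; last by right.
    by rewrite mx2_unit mulr0 subr0 mul1r.
  by rewrite mx2_unit mulr0 subr0 mul1r invr_eq0.
move=> a b c; rewrite !mx2_tr !mx2_mul !mx2_scale !mx2_add.
by congr mx2; field.
Qed.

Lemma det_comb3_equiv A B C (P Q : 'M[K]_2) a b c :
  \det (a *: (P *m A *m Q) + b *: (P *m B *m Q) + c *: (P *m C *m Q))
  = \det P * \det Q * \det (a *: A + b *: B + c *: C).
Proof.
rewrite -mulrAC -!det_mulmx; congr (\det _).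
by rewrite !mulmxDr !mulmxDl -!scalemxAr -!scalemxAl.
Qed.

Lemma mul_unit_neq0 (P Q B : 'M[K]_2) : P \in unitmx -> Q \in unitmx ->
  B != 0 -> P *m B *m Q != 0.
Proof.
move=> uP uQ; apply: contraNneq => /(canRL (mulmxK uQ)); rewrite mul0mx.
by move/(canRL (mulKmx uP)) ->; rewrite mulmx0.
Qed.

Lemma rank1_equiv A : A != 0 -> \det A = 0 ->
  exists P Q : 'M[K]_2, [/\ P \in unitmx, Q \in unitmx &
    P *m A *m Q = mx2 1 0 0 0].
Proof.
move=> nzA dA.
have rA : \rank A = 1%N.
  have: (0 < \rank A)%N by rewrite lt0n mxrank_eq0.
  have: (\rank A != 2)%N.
    by rewrite -[_ == _]/(row_free A) row_free_unit unitmx_det_neq0 dA eqxx.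
  by have := rank_leq_row A; case: (\rank A) => [|[|[]]].
exists (invmx (col_ebase A)), (invmx (row_ebase A)).
rewrite !unitmx_inv col_ebase_unit row_ebase_unit; split=> //.
rewrite -[X in _ *m X *m _]mulmx_ebase -!mulmxA mulmxV ?row_ebase_unit //.
rewrite mulmx1 mulKmx ?col_ebase_unit // rA.
by rewrite [LHS]mx2_eta !mxE.
Qed.

(** A triple A, B, C with the determinant of a multiple of (a, b; s b, c) is
reduced to A = E11 and C = E22. Since A is singular and nonzero, it can be made
equal to E11; the proportionality constant is then polar A C, the last entry of
C, which serves as a pivot to clear the other entries of C while E11 is
preserved. *)
Lemma Frobenius_of_det s k A B C : k != 0 -> B != 0 ->
  (forall a b c, \det (a *: A + b *: B + c *: C) = k * (a * c - s * b ^+ 2)) ->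
  Frobenius_fits s A B C.
Proof.
move=> k0 B0 H.
have dA : \det A = 0.
  have := H 1 0 0; rewrite !scale0r !addr0 scale1r => ->.
  by rewrite expr0n !mulr0 subr0 mulr0.
have A0 : A != 0.
  apply/eqP => A0; have := H 1 0 1; have := H 0 0 1.
  rewrite A0 !scaler0 !scale0r !add0r => -> /eqP.
  rewrite expr0n !(mulr0, mul0r, subr0, mulr1).
  by rewrite eq_sym (negPf k0).
have [P [Q [uP uQ PAQ]]] := rank1_equiv A0 dA.
apply: (Frobenius_fits_equiv uP uQ); rewrite PAQ.
have {}B0 := mul_unit_neq0 uP uQ B0.
have {H}H a b c : \det (a *: mx2 1 0 0 0 + b *: (P *m B *m Q) + c *: (P *m C *m Q))
    = \det P * \det Q * k * (a * c - s * b ^+ 2).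
  by rewrite -mulrA -H -det_comb3_equiv PAQ.
have {}k0 : \det P * \det Q * k != 0.
  by rewrite !mulf_neq0 // -unitmx_det_neq0.
move: (P *m B *m Q) (P *m C *m Q) (\det P * \det Q * k) k0 H B0 => {A PAQ dA A0}.
move=> {uP uQ P Q B C k} B C k k0 H B0.
have dC : \det C = 0.
  have := H 0 0 1; rewrite !scale0r !add0r scale1r => ->.
  by rewrite expr0n !(mulr0, mul0r) subr0 mulr0.
have C11 : C 1 1 = k.
  have := H 1 0 1; rewrite det_comb3 dC det_mx2 /polar !mxE /= expr0n expr1n /=.
  by rewrite !(mulr0, mul0r, mulr1, mul1r, oppr0, addr0, add0r).
move: dC; rewrite det_mx22 C11 => dC.
pose P := mx2 1 (- C 0 1 / k) 0 1.
pose Q := mx2 1 0 (- C 1 0 / k) k^-1.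
have uP : P \in unitmx by rewrite mx2_unit mulr0 subr0 mulr1 oner_eq0.
have uQ : Q \in unitmx by rewrite mx2_unit mul0r subr0 mul1r invr_eq0.
apply: (Frobenius_fits_equiv uP uQ).
have PAQ : P *m mx2 1 0 0 0 *m Q = mx2 1 0 0 0.
  by rewrite !mx2_mul; congr mx2; ring.
have PCQ : P *m C *m Q = mx2 0 0 0 1.
  have C00 : C 0 0 = C 0 1 * C 1 0 / k.
    by apply: (canRL (mulfK k0)); apply/eqP; rewrite -subr_eq0 dC.
  rewrite [C]mx2_eta !mx2_mul C11 C00; congr mx2; by field.
rewrite PAQ PCQ; apply: (@Frobenius_fits_diag _ (\det P * \det Q * k)).
  exact: mul_unit_neq0.
move=> a b c; have := det_comb3_equiv (mx2 1 0 0 0) B C P Q a b c.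
by rewrite PAQ PCQ H mulrA.
Qed.

(** * Forms vanishing on two planes or on a conic *)

(** A ternary quadratic form vanishing on the planes a = 0 and c = 0 is a multiple
of a c. *)
Lemma det_comb3_two_planes A B C :
  (forall a b c, a * c = 0 -> \det (a *: A + b *: B + c *: C) = 0) ->
  forall a b c, \det (a *: A + b *: B + c *: C) = polar A C * (a * c).
Proof.
move=> H.
have {}H a b c : a * c = 0 -> \det A * a ^+ 2 + \det B * b ^+ 2 + \det C * c ^+ 2
  + polar A B * (a * b) + polar B C * (b * c) + polar A C * (a * c) = 0.
  by move/(H a b c); rewrite det_comb3.
have S := (expr0n, expr1n, mulr0, mul0r, mulr1, mul1r, addr0, add0r).
have dA : \det A = 0 by rewrite -[RHS](H 1 0 0) /= !S.
have dB : \det B = 0 by rewrite -[RHS](H 0 1 0) /= !S.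
have dC : \det C = 0 by rewrite -[RHS](H 0 0 1) /= !S.
have AB : polar A B = 0 by rewrite -[RHS](H 1 1 0) /= ?dA ?dB !S.
have BC : polar B C = 0 by rewrite -[RHS](H 0 1 1) /= ?dC ?dB !S.
by move=> a b c; rewrite det_comb3 dA dB dC AB BC; ring.
Qed.

(** The conditions for a ternary quadratic form to vanish on the conic a c = b^2,
read off at the points (1, 0, 0), (0, 0, 1) and (x^2, x, 1); at the last ones
the factor x has been divided out. *)
Lemma det_comb3_conic_coefs A B C :
  (forall a b c, a * c = b ^+ 2 -> \det (a *: A + b *: B + c *: C) = 0) ->
  [/\ \det A = 0, \det C = 0 & forall x, x != 0 ->
   polar A B * x ^+ 2 + (\det B + polar A C) * x + polar B C = 0].
Proof.
move=> H.
have {}H a b c : a * c = b ^+ 2 -> \det A * a ^+ 2 + \det B * b ^+ 2 + \det C * c ^+ 2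
  + polar A B * (a * b) + polar B C * (b * c) + polar A C * (a * c) = 0.
  by move/(H a b c); rewrite det_comb3.
have S := (expr0n, expr1n, mulr0, mul0r, mulr1, mul1r, addr0, add0r).
have dA : \det A = 0 by rewrite -[RHS](H 1 0 0) /= !S.
have dC : \det C = 0 by rewrite -[RHS](H 0 0 1) /= !S.
split=> // x x0; apply: (mulfI x0); rewrite mulr0.
by rewrite -[RHS](H (x ^+ 2) x 1) ?mulr1 // dA dC; ring.
Qed.

Lemma eq0_sub (u v w : K) : u = 0 -> v = 0 -> w = u - v -> w = 0.
Proof. by move=> -> -> ->; rewrite subrr. Qed.

Lemma quadratic_3roots (d e g x y z : K) :
  x != y -> y != z -> x != z ->
  d * x ^+ 2 + e * x + g = 0 -> d * y ^+ 2 + e * y + g = 0 ->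
  d * z ^+ 2 + e * z + g = 0 -> [/\ d = 0, e = 0 & g = 0].
Proof.
move=> xy yz xz Hx Hy Hz.
have Exy : d * (x + y) + e = 0.
  have: x - y != 0 by rewrite subr_eq0.
  move/mulfI; apply; rewrite mulr0; apply: (eq0_sub Hx Hy); ring.
have Eyz : d * (y + z) + e = 0.
  have: y - z != 0 by rewrite subr_eq0.
  move/mulfI; apply; rewrite mulr0; apply: (eq0_sub Hy Hz); ring.
have d0 : d = 0.
  have: x - z != 0 by rewrite subr_eq0.
  move/mulfI; apply; rewrite mulr0; apply: (eq0_sub Exy Eyz); ring.
have e0 : e = 0 by rewrite -Exy d0 mul0r add0r.
by split=> //; rewrite -Hx d0 e0 !mul0r !add0r.
Qed.

(** The field has at least three distinct nonzero elements. *)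
Definition three_units := exists x y z : K,
  [/\ x != 0, y != 0, z != 0 & [/\ x != y, y != z & x != z]].

(** That is, the field has two or three elements. *)
Lemma three_unitsPn : ~ three_units -> forall x : K, [\/ x = 0, x = 1 | x = -1].
Proof.
move=> H x; have [->|x0] := eqVneq x 0; first by constructor 1.
have [->|x1] := eqVneq x 1; first by constructor 2.
have [->|xN1] := eqVneq x (-1); first by constructor 3.
case: H; have [N1|N1] := eqVneq (-1) (1 : K); last first.
  exists 1, (-1), x; rewrite oppr_eq0 oner_eq0 x0; split=> //.
  by rewrite ![_ == x]eq_sym eq_sym N1 x1 xN1.
(* In characteristic 2, the three elements are 1, x and x + 1. *)
exists 1, x, (x + 1); rewrite oner_eq0 x0 addr_eq0 xN1; split=> //.
rewrite eq_sym x1; split=> //.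
  by rewrite -subr_eq0 opprD addNKr oppr_eq0 oner_eq0.
by rewrite -subr_eq0 opprD addrCA subrr addr0 oppr_eq0.
Qed.

(** Over a field with two or three elements, the conditions of
[det_comb3_conic_coefs] alone allow other forms than the multiples of
a c - b^2, but those are degenerate: here d, e, b, z stand for polar A B,
polar B C, det B, polar A C, and z (b z - d e) is, up to
sign, the half-discriminant of the form. *)
Lemma small_field_coefs (d e b z : K) : ~ three_units ->
  z * (b * z - d * e) != 0 ->
  (forall x, x != 0 -> d * x ^+ 2 + (b + z) * x + e = 0) ->
  [/\ d = 0, b + z = 0 & e = 0].
Proof.
move=> H3 D H.
have sq x : x != 0 -> x ^+ 2 = 1 :> K.
  by case: (three_unitsPn H3 x) => ->; rewrite ?eqxx // ?sqrrN expr1n.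
have [z0 D'] : z != 0 /\ b * z - d * e != 0 by apply/andP; rewrite -negb_or -mulf_eq0.
have := H 1 (oner_neq0 _); rewrite expr1n !mulr1 => H1.
have := H (-1); rewrite oppr_eq0 oner_eq0 sqrrN expr1n mulr1 mulrN1 => /(_ isT) HN.
have [N1|N1] := eqVneq (-1) (1 : K); last first.
  (* Three elements: b = - z and e = - d, and d^2 = z^2 = 1 if d is nonzero. *)
  have two : 2%:R != 0 :> K.
    by apply: contraNneq N1 => t0; rewrite eq_sym -subr_eq0 opprK -[1 + 1]/(2%:R) t0.
  have bz : b + z = 0.
    by apply: (mulfI two); rewrite mulr0; apply: (eq0_sub H1 HN); ring.
  move: H1; rewrite bz addr0 => de.
  have [d0|d0] := eqVneq d 0; first by rewrite d0 add0r in de.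
  case/negP: D'; have -> : b = - z by apply/eqP; rewrite -addr_eq0 bz.
  have -> : e = - d by apply/eqP; rewrite -addr_eq0 addrC de.
  by rewrite mulNr mulrN opprK -!expr2 !sq // addrC subrr.
(* Two elements: every nonzero element is 1, and signs do not matter. *)
have one x : x != 0 -> x = 1 :> K.
  by case: (three_unitsPn H3 x) => ->; rewrite ?eqxx ?N1.
have chr2 (x : K) : x + x = 0 by rewrite -{2}[x]mul1r -N1 mulN1r subrr.
have opp (x : K) : - x = x by apply/esym/eqP; rewrite -addr_eq0 chr2.
move: D' H1; rewrite (one z z0) mulr1 opp.
have [->|/one ->] := eqVneq d 0.
  have [->|/one ->] := eqVneq e 0; first by rewrite add0r addr0.
  move=> + E; case/negP; apply/eqP.
  by apply: (eq0_sub E (chr2 1)); ring.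
move=> + E; case/negP; apply/eqP.
by apply: (eq0_sub E (chr2 1)); ring.
Qed.

(** Up to sign, the left-hand side is the half-discriminant of the quadratic form
det (a A + b B + c C) when det A = det C = 0. If it were zero, the form would
vanish on a plane, while by hypothesis any two triples spanning a totally
singular subspace have vanishing minors. *)
Lemma det_comb3_disc_neq0 A B C :
  \det A = 0 -> \det C = 0 ->
  (forall a b c a' b' c',
    (forall x y, \det ((x * a + y * a') *: A + (x * b + y * b') *: B
                 + (x * c + y * c') *: C) = 0) ->
    a * b' = a' * b /\ a * c' = a' * c) ->
  polar A C * (\det B * polar A C - polar A B * polar B C) != 0.
Proof.
move=> dA dC H.
have z0 : polar A C != 0.
  (* If polar A C = 0, the form vanishes on the plane b = 0. *)
  apply/eqP=> z0; have [] := H 1 0 0 0 0 1.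
    by move=> x y; rewrite det_comb3 dA dC z0; ring.
  by move=> _ /eqP; rewrite mulr1 mulr0 oner_eq0.
rewrite mulf_neq0 //; apply/eqP => D.
(* Otherwise the plane is spanned by (1, 0, 0) and a vector (0, 1, m), where m is
   chosen to make these orthogonal for the polar form. *)
have [] := H 1 0 0 0 1 (- polar A B / polar A C).
  move=> x y; rewrite det_comb3 dA dC.
  transitivity (y ^+ 2 / polar A C *
      (\det B * polar A C - polar A B * polar B C)); first by field.
  by rewrite D mulr0.
by move=> /eqP; rewrite mulr1 mulr0 oner_eq0.
Qed.

(** A form det (a A + b B + c C) vanishing on the conic a c = b^2 is a multiple of
a c - b^2, provided that the field is large enough or that the form has no
totally singular plane. *)
Lemma det_comb3_conic A B C :
  (forall a b c, a * c = b ^+ 2 -> \det (a *: A + b *: B + c *: C) = 0) ->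
  three_units \/
  (forall a b c a' b' c',
    (forall x y, \det ((x * a + y * a') *: A + (x * b + y * b') *: B
                 + (x * c + y * c') *: C) = 0) ->
    a * b' = a' * b /\ a * c' = a' * c) ->
  forall a b c, \det (a *: A + b *: B + c *: C) = polar A C * (a * c - b ^+ 2).
Proof.
move=> /det_comb3_conic_coefs[dA dC H] H3.
have [d0 bz e0] : [/\ polar A B = 0, \det B + polar A C = 0 & polar B C = 0].
  have [[x [y [z [x0 y0 z0 [xy yz xz]]]]]|n3] := EM three_units.
    by apply: (quadratic_3roots xy yz xz); apply: H.
  case: H3 => // /(det_comb3_disc_neq0 dA dC) D; exact: small_field_coefs.
move=> a b c; rewrite det_comb3 dA dC d0 e0.
have -> : \det B = - polar A C by apply/eqP; rewrite -addr_eq0 bz.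
by ring.
Qed.

(** Two symmetric matrices spanning a space of singular matrices have proportional
entries: the square of each 2 x 2 minor is a combination of the determinants
and of their polarization. *)
Lemma sym_singular_plane_dep (a b c a' b' c' : K) :
  (forall x y, \det (x *: mx2 a b b c + y *: mx2 a' b' b' c') = 0) ->
  [/\ a * b' = a' * b, a * c' = a' * c & b * c' = b' * c].
Proof.
move=> H.
have {}H x y : (x * a + y * a') * (x * c + y * c') = (x * b + y * b') ^+ 2.
  apply/eqP; rewrite -subr_eq0 -[X in _ == X](H x y).
  by rewrite !mx2_scale mx2_add det_mx2.
have := H 1 0; rewrite !(mul0r, mul1r, addr0) => H1.
have := H 0 1; rewrite !(mul0r, mul1r, add0r) => H2.
have := H 1 1; rewrite !mul1r => H3.
have pol : a * c' + a' * c - 2%:R * (b * b') = 0.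
  transitivity ((a + a') * (c + c') - (b + b') ^+ 2 - (a * c - b ^+ 2)
                - (a' * c' - b' ^+ 2)); first by ring.
  by rewrite H1 H2 H3 !subrr.
have sq (x y : K) : (x - y) ^+ 2 = 0 -> x = y.
  by move/eqP; rewrite expf_eq0 subr_eq0 => /eqP.
split; apply: sq.
- transitivity (a * a' * (a * c' + a' * c - 2%:R * (b * b'))
    - a ^+ 2 * (a' * c' - b' ^+ 2) - a' ^+ 2 * (a * c - b ^+ 2)); first by ring.
  by rewrite pol H1 H2 !subrr !mulr0 !subr0.
- transitivity ((a * c' + a' * c - 2%:R * (b * b')) * (a * c' + a' * c + 2%:R * (b * b'))
    - 4%:R * (a' * c') * (a * c - b ^+ 2)
    - 4%:R * b ^+ 2 * (a' * c' - b' ^+ 2)); first by ring.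
  by rewrite pol H1 H2 !subrr !(mulr0, mul0r) !subr0.
- transitivity (c * c' * (a * c' + a' * c - 2%:R * (b * b'))
    - c ^+ 2 * (a' * c' - b' ^+ 2) - c' ^+ 2 * (a * c - b ^+ 2)); first by ring.
  by rewrite pol H1 H2 !subrr !mulr0 !subr0.
Qed.

End TwoByTwo.

Lemma card_gt3_three_units (K : fieldType) :
  ~ ([set: K]%classic #<= `I_3)%card -> three_units K.
Proof.
move=> H; apply: contrapT => /three_unitsPn n3; apply: H.
pose g (n : nat) : K := nth 0 [:: 0; 1; -1] n.
apply: card_le_trans (card_image_le g `I_3).
apply: subset_card_le => x _; case: (n3 x) => ->.
- by exists 0%N.
- by exists 1%N.
- by exists 2%N.
Qed.

(** * Normal form of hyperplanes *)

Lemma hyperplane_trace (K : fieldType) n (V : {vspace 'M[K]_n}) :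
  is_hyperplane V ->
  exists2 A : 'M[K]_n, A != 0 & forall M, (M \in V) = (\tr (A *m M) == 0).
Proof.
move=> hV; have dC : \dim (V^C)%VS = 1%N.
  by rewrite dimv_compl -hV subSnn.
pose X : (\dim V^C).-tuple 'M[K]_n := vbasis V^C.
pose i0 : 'I_(\dim V^C) := cast_ord (esym dC) ord0.
have i0P i : i = i0.
  by apply: val_inj; case: i => i /= ; rewrite dC; case: i.
pose pi := daddv_pi V^C V.
have cap0 : (V^C :&: V)%VS = 0%VS by rewrite capvC capv_compl.
have piP M : (M \in V) = (pi M == 0).
  apply/idP/eqP => [MV|pM0].
    have := daddv_pi_add (w := M) cap0; rewrite addvC addv_complf memvf.
    rewrite (daddv_pi_id _ MV) 1?capvC // -/pi => /(_ isT).
    by move/(canRL (addrK _)); rewrite subrr.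
  have := daddv_pi_add (w := M) cap0; rewrite addvC addv_complf memvf -/pi pM0.
  by rewrite add0r => /(_ isT) <-; exact: memv_pi.
pose phi M := coord X i0 (pi M).
have phiP M : (M \in V) = (phi M == 0).
  rewrite piP; apply/eqP/eqP => [pM|pM]; first by rewrite /phi pM linear0.
  rewrite (coord_vbasis (memv_pi V^C V M)) big1 // => i _.
  by rewrite (i0P i) -/pi -/(phi M) pM scale0r.
(* phi is a linear form with kernel V; A represents it for the trace pairing. *)
pose A := \matrix_(i, j) phi (delta_mx j i).
have phiE M : phi M = \tr (A *m M).
  rewrite [M in LHS]matrix_sum_delta /phi !linear_sum /=.
  under eq_bigr do rewrite !linear_sum /=.
  rewrite exchange_big; apply: eq_bigr => j _; rewrite mxE.
  by apply: eq_bigr => i _; rewrite !linearZ /= mxE mulrC.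
exists A => [|M]; last by rewrite phiP phiE.
apply/eqP=> A0; have VT : V = fullv.
  by apply/vspaceP => M; rewrite memvf phiP phiE A0 mul0mx mxtrace0 eqxx.
by move: hV; rewrite /is_hyperplane VT => /esym/n_Sn.
Qed.

(** Writing A = L (pid_mx r) U with L and U invertible, tr (A M) is the sum of the
first r diagonal entries of U M L. Exchanging the rows of U M L, with one change
of sign, moves these entries to the antidiagonal. *)
Lemma hyperplane_normal_form (K : fieldType) (V : {vspace 'M[K]_2}) :
  is_hyperplane V ->
  exists (s : bool) (P Q : 'M[K]_2), [/\ P \in unitmx, Q \in unitmx &
    forall M, (M \in V) = ((P *m M *m Q) 1 0 == s%:R * (P *m M *m Q) 0 1)].
Proof.
move=> /hyperplane_trace[A A0 VP].
pose S : 'M[K]_2 := mx2 0 (-1) 1 0.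
exists (\rank A == 2%N), (S *m row_ebase A), (col_ebase A).
rewrite unitmx_mul row_ebase_unit col_ebase_unit andbT mx2_unit mul0r sub0r.
rewrite mulN1r opprK oner_eq0; split=> // M; rewrite {}VP.
rewrite -[A in \tr (A *m M)]mulmx_ebase -!mulmxA mxtrace_mulC !mulmxA.
rewrite -(mulmxA S) -(mulmxA S).
have: (0 < \rank A)%N by rewrite lt0n mxrank_eq0.
have := rank_leq_row A.
rewrite -(mulmxA _ (row_ebase A)) -(mulmxA _ _ (col_ebase A)).
move: (row_ebase A *m M *m col_ebase A) => N.
rewrite [N]mx2_eta !mx2_mul !mxE /= !(mul0r, mul1r, add0r, addr0, mulN1r).
case: (\rank A) => [|[|[]]] //= _ _.
  have -> : pid_mx 1 = mx2 1 0 0 0 :> 'M[K]_2 by rewrite [LHS]mx2_eta !mxE.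
  rewrite mx2_mul /mxtrace !big_ord_recl big_ord0 !mxE /=.
  by rewrite !(mul0r, mul1r, addr0).
rewrite pid_mx_1 mul1mx /mxtrace !big_ord_recl big_ord0 !mxE /= addr0.
by rewrite mul1r addr_eq0.
Qed.

Lemma equivalent_upper_triangular (K : fieldType) (V : {vspace 'M[K]_2})
    (P Q : 'M[K]_2) :
  P \in unitmx -> Q \in unitmx ->
  (forall M, (M \in V) = ((P *m M *m Q) 1 0 == 0)) ->
  equivalent_spaces V (upper_triangular K 2).
Proof.
move=> uP uQ VP; exists P, (invmx Q); rewrite unitmx_inv; split=> //.
rewrite invmxK; apply/vspaceP => T; apply/idP/memv_imgP => [TT|[M MV ->]].
  exists (invmx P *m T *m invmx Q).
    rewrite VP !mulmxA mulmxKV // mulmxV // mul1mx.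
    exact/eqP/(upper_triangularP _ TT).
  by rewrite lfunE /= !mulmxA mulmxKV // mulmxV // mul1mx.
rewrite lfunE /=; apply/upper_triangularP => -[[|[|//]] hi] [[|[|//]] hj] // _.
move: MV; rewrite VP => /eqP E; rewrite -[RHS]E.
by congr (_ _ _); apply: val_inj.
Qed.

(** * Parametrized hyperplanes *)

(** g is a bijection onto the space of matrices (a, b; t b, c). The source U is
abstract so that the maps v |-> P v Q and v |-> P' (f v) Q' on a hyperplane V
are treated alike. *)
Definition parametrizes (K : fieldType) (t : K) (U : lmodType K)
    (g : U -> 'M[K]_2) :=
  injective g /\ forall N : 'M[K]_2, N 1 0 = t * N 0 1 <-> exists v, g v = N.

Lemma parametrizes_coords (K : fieldType) (t : K) (U : lmodType K)
    (g : {linear U -> 'M[K]_2}) : parametrizes t g ->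
  exists x y z : U,
    (forall a b c, g (a *: x + b *: y + c *: z) = mx2 a b (t * b) c) /\
    (forall v, exists a b c, v = a *: x + b *: y + c *: z).
Proof.
move=> [g_inj gP].
have [|x gx] := (gP (mx2 1 0 0 0)).1; first by rewrite !mxE mulr0.
have [|y gy] := (gP (mx2 0 1 t 0)).1; first by rewrite !mxE mulr1.
have [|z gz] := (gP (mx2 0 0 0 1)).1; first by rewrite !mxE mulr0.
have gE a b c : g (a *: x + b *: y + c *: z) = mx2 a b (t * b) c.
  rewrite !linearD !linearZ /= gx gy gz !mx2_scale !mx2_add.
  by congr mx2; ring.
exists x, y, z; split=> // v.
exists (g v 0 0), (g v 0 1), (g v 1 1); apply: g_inj; rewrite gE.
by rewrite -((gP _).2 (ex_intro _ v erefl)) -mx2_eta.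
Qed.

(** If w and w' span a space on which h takes singular symmetric values, then w and
w' are linearly dependent, hence so are their images under any linear g. *)
Lemma sym_singular_plane_minors (K : fieldType) (U : lmodType K)
    (h : {linear U -> 'M[K]_2}) (g : {linear U -> 'M[K]_2}) (w w' : U) :
  parametrizes 1 h ->
  (forall x y, \det (h (x *: w + y *: w')) = 0) ->
  forall i j k l, g w i j * g w' k l = g w' i j * g w k l.
Proof.
move=> [h_inj hP] H i j k l.
have hE v : h v = mx2 (h v 0 0) (h v 0 1) (h v 0 1) (h v 1 1).
  by rewrite [LHS]mx2_eta ((hP (h v)).2 (ex_intro _ v erefl)) mul1r.
have hZ x v : x *: h v =
    mx2 (x * h v 0 0) (x * h v 0 1) (x * h v 0 1) (x * h v 1 1).
  by rewrite {1}hE mx2_scale.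
have dep (x x' : K) : x != 0 -> x' *: h w = x *: h w' ->
  g w i j * g w' k l = g w' i j * g w k l.
  move=> x0; rewrite -!linearZ => /h_inj/(congr1 g); rewrite !linearZ /= => E.
  have := congr1 (fun M : 'M_2 => M i j) E; have := congr1 (fun M : 'M_2 => M k l) E.
  rewrite !mxE => E1 E2; apply: (mulfI x0).
  by rewrite mulrCA -E1 [RHS]mulrA -E2; ring.
have [] := @sym_singular_plane_dep K (h w 0 0) (h w 0 1) (h w 1 1)
  (h w' 0 0) (h w' 0 1) (h w' 1 1).
  by move=> x y; rewrite -!hE -!linearZ -linearD.
move=> E1 E2 E3.
have [p0|p0] := eqVneq (h w 0 0) 0; last first.
  apply: (dep _ (h w' 0 0) p0); rewrite !hZ.
  by congr mx2; [rewrite mulrC|rewrite E1|rewrite E1|rewrite E2].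
have [q0|q0] := eqVneq (h w 0 1) 0; last first.
  apply: (dep _ (h w' 0 1) q0); rewrite !hZ.
  by congr mx2; [rewrite mulrC E1 mulrC|rewrite mulrC|rewrite mulrC|rewrite E3].
have [r0|r0] := eqVneq (h w 1 1) 0; last first.
  apply: (dep _ (h w' 1 1) r0); rewrite !hZ.
  by congr mx2; [rewrite mulrC E2 mulrC|rewrite mulrC E3 mulrC
    |rewrite mulrC E3 mulrC|rewrite mulrC].
have -> : w = 0.
  apply: h_inj; rewrite hE linear0 p0 q0 r0.
  by rewrite [RHS]mx2_eta !mxE.
by rewrite linear0 !mxE mul0r mulr0.
Qed.

(** The determinant of h is expressed in the coordinates (a, b, c) provided by g,
where it vanishes if a c = t b^2. *)
Lemma det_proportional (K : fieldType) (s t : bool) (U : lmodType K)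
    (h g : {linear U -> 'M[K]_2}) :
  parametrizes s%:R h -> parametrizes t%:R g ->
  (forall v, h v \in unitmx -> g v \in unitmx) ->
  three_units K \/ s ->
  exists2 k : K, k != 0 & forall v, \det (h v) = k * \det (g v).
Proof.
move=> hN gN hg Hs.
have [x [y [z [gE span]]]] := parametrizes_coords gN.
have detg a b c : \det (g (a *: x + b *: y + c *: z)) = a * c - t%:R * b ^+ 2.
  by rewrite gE det_mx2 mulrCA expr2.
have hE a b c : a *: h x + b *: h y + c *: h z = h (a *: x + b *: y + c *: z).
  by rewrite !linearD !linearZ.
have sing a b c : a * c = t%:R * b ^+ 2 ->
    \det (a *: h x + b *: h y + c *: h z) = 0.
  move=> E; rewrite hE; set v := (_ + _ + _); have [//|] := eqVneq (\det (h v)) 0.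
  by rewrite -unitmx_det_neq0 => /hg; rewrite unitmx_det_neq0 detg E subrr eqxx.
have [k kE] : exists k, forall a b c,
    \det (a *: h x + b *: h y + c *: h z) = k * (a * c - t%:R * b ^+ 2).
  exists (polar (h x) (h z)) => a b c; case: t {gN} gE detg sing => gE detg sing.
    rewrite mul1r; apply: det_comb3_conic => [{}a {}b {}c E|].
      by apply: sing; rewrite mul1r.
    case: Hs => [|s1]; [by left|right]; rewrite s1 in hN.
    move=> {}a {}b {}c a' b' c' H.
    have H' u v : \det (h (u *: (a *: x + b *: y + c *: z)
                   + v *: (a' *: x + b' *: y + c' *: z))) = 0.
      rewrite -[RHS](H u v) hE; congr (\det (h _)).
      by rewrite !scalerDr !scalerDl !scalerA addrACA [X in X + _ = _]addrACA.
    have D := sym_singular_plane_minors g hN H'.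
    split; first by have := D 0 0 0 1; rewrite !gE !mxE.
    by have := D 0 0 1 1; rewrite !gE !mxE.
  rewrite mul0r subr0; apply: det_comb3_two_planes => {}a {}b {}c E.
  by apply: sing; rewrite mul0r.
exists k => [|v]; last first.
  by have [a [b [c ->]]] := span v; rewrite -hE kE detg.
(* k is nonzero because h reaches the identity matrix. *)
have [|v hv] := (hN.2 (mx2 1 0 0 1)).1; first by rewrite !mxE mulr0.
have [a [b [c vE]]] := span v.
have := kE a b c; rewrite hE -vE hv det_mx2 mulr0 subr0 mulr1.
by apply: contra_eq_neq => ->; rewrite mul0r oner_neq0.
Qed.

Lemma Frobenius_of_parametrizations (K : fieldType) (s t : bool) (U : lmodType K)
    (h g : {linear U -> 'M[K]_2}) :
  parametrizes s%:R h -> parametrizes t%:R g ->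
  (forall v, h v \in unitmx -> g v \in unitmx) ->
  three_units K \/ s ->
  exists u, is_Frobenius u /\ forall v, u (h v) = g v.
Proof.
move=> hN gN hg Hs.
have [k k0 kE] := det_proportional hN gN hg Hs.
have [x [y [z [hE span]]]] := parametrizes_coords hN.
have gE a b c : a *: g x + b *: g y + c *: g z = g (a *: x + b *: y + c *: z).
  by rewrite !linearD !linearZ.
have [||a b c|u [uF uE]] := @Frobenius_of_det K s%:R k^-1 (g x) (g y) (g z).
- by rewrite invr_eq0.
- apply/eqP => gy0; have y0 : y = 0 by apply: gN.1; rewrite gy0 linear0.
  have := hE 0 1 0; rewrite y0 !scale0r !scaler0 !addr0 linear0.
  move/(congr1 (fun M : 'M_2 => M 0 1)); rewrite !mxE => /eqP.
  by rewrite eq_sym oner_eq0.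
- rewrite gE; apply: (canRL (mulKf k0)); rewrite -kE hE det_mx2.
  by rewrite mulrCA expr2.
exists u; split=> // v; have [a [b [c ->]]] := span v.
by rewrite hE uE gE.
Qed.

Lemma parametrizes_equiv (K : fieldType) (V : {vspace 'M[K]_2}) (P Q : 'M[K]_2)
    (t : K) (U : lmodType K) (g : {linear U -> 'M[K]_2}) :
  P \in unitmx -> Q \in unitmx -> injective g ->
  (forall M, M \in V <-> exists v, g v = M) ->
  (forall M, (M \in V) = ((P *m M *m Q) 1 0 == t * (P *m M *m Q) 0 1)) ->
  parametrizes t (mulmxr Q \o mulmx P \o g).
Proof.
move=> uP uQ g_inj gV VE; split=> [v w /= /(can_inj (mulmxK uQ))|N].
  by move/(can_inj (mulKmx uP))/g_inj.
have NE : P *m (invmx P *m N *m invmx Q) *m Q = N.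
  by rewrite !mulmxA mulmxKV // mulmxV // mul1mx.
split=> [Nt|[v <-] /=].
  have /gV[v gv] : invmx P *m N *m invmx Q \in V by rewrite VE NE; apply/eqP.
  by exists v; rewrite /= gv NE.
by apply/eqP; rewrite -VE; apply/gV; exists v.
Qed.

(** * The extension theorem *)

Theorem proposition25 (K : fieldType) (V : {vspace 'M[K]_2})
    (f : {linear subvs_of V -> 'M[K]_2})
    (hV : is_hyperplane V)
    (f_inj : injective f)
    (f_unit : forall v : subvs_of V, vsval v \in unitmx -> f v \in unitmx)
    (hexc : ~ (equivalent_spaces V (upper_triangular K 2)
               /\ ([set: K]%classic #<= `I_3)%card)) :
  exists u : 'M[K]_2 -> 'M[K]_2,
    is_Frobenius u /\ (forall v : subvs_of V, u (vsval v) = f v).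
Proof.
pose W := limg (linfun f).
have WP M : M \in W <-> exists v, f v = M.
  split=> [/memv_imgP[v _ ->]|[v <-]]; first by exists v; rewrite lfunE.
  by rewrite -(lfunE f) memv_img // memvf.
have hW : is_hyperplane W.
  rewrite /is_hyperplane -hV /W limg_dim_eq ?dimvf //.
  by rewrite capfv; apply/eqP/lker0P => x y; rewrite !lfunE; apply: f_inj.
have [s [P [Q [uP uQ VE]]]] := hyperplane_normal_form hV.
have [t [P' [Q' [uP' uQ' WE]]]] := hyperplane_normal_form hW.
have VP M : M \in V <-> exists v : subvs_of V, vsval v = M.
  by split=> [MV|[v <-]]; [exists (Subvs MV)|exact: subvsP].
have hN := parametrizes_equiv uP uQ (val_inj : injective vsval) VP VE.
have gN := parametrizes_equiv uP' uQ' f_inj WP WE.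
have [v||u [uF uE]] := Frobenius_of_parametrizations hN gN.
- by rewrite /= !unitmx_mul uP uP' uQ uQ' !andbT; exact: f_unit.
- case: s VE {hN} => VE; [by right|left].
  apply: card_gt3_three_units => le3; apply: hexc; split=> //.
  by apply: (equivalent_upper_triangular uP uQ) => M; rewrite VE mul0r.
exists (fun M => invmx P' *m u (P *m M *m Q) *m invmx Q'); split.
  have := Frobenius_comp_mul uP uQ uF.
  by apply: Frobenius_mul; rewrite unitmx_inv.
by move=> v; rewrite uE /= !mulmxA mulmxK // mulVmx // mul1mx.
Qed.
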